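(* Let $V$ be a complete DVR, with quotient field $K$, whose residue field is algebraically closed or real closed. Then there is no extension of $V$ to $K(X)$ which is a DVR and residually algebraic over $V$.
   Context: A DVR is a discrete valuation domain of rank one (value group isomorphic to $\mathbb{Z}$); $X$ is an indeterminate over $K$. An extension of $V$ to $K(X)$ is a valuation domain $W$ of $K(X)$ with $W\cap K=V$; it is residually algebraic over $V$ if its residue field is algebraic over the residue field of $V$. *)

(* Defs.v *)
From HB Require Import structures.
From mathcomp Require Import all_boot all_order all_algebra.

Set Implicit Arguments.
Unset Strict Implicit.
Unset Printing Implicit Defensive.

Import Order.TTheory GRing.Theory Num.Theory.
Local Open Scope ring_scope.
Local Open Scope quotient_scope.

(* A valuation domain is given as a subring of its quotient field: the third
   field of the record forces the quotient field to be K. *)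
Record valring (K : fieldType) := ValRing {
  valring_pred :> {pred K};
  valring_subring : subring_closed valring_pred;
  valring_total : forall x, (x \in valring_pred) || (x^-1 \in valring_pred)
}.

HB.instance Definition _ (K : fieldType) (V : valring K) :=
  GRing.isSubringClosed.Build K (valring_pred V) (valring_subring V).

Section ResidueField.
Variables (K : fieldType) (V : valring K).

Record valring_type := ValRingElt { valring_val : K; _ : valring_val \in V }.

HB.instance Definition _ := [isSub for valring_val].
HB.instance Definition _ := [Choice of valring_type by <:].
HB.instance Definition _ := [SubChoice_isSubComNzRing of valring_type by <:].

(* The set of nonunits of V. *)
Definition maxideal (a : valring_type) : bool :=
  (a == 0) || ((val a)^-1 \notin V).

Lemma maxidealPn (a : valring_type) :
  reflect (exists b, a * b = 1) (a \notin maxideal).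
Proof.
rewrite unfold_in /maxideal negb_or negbK -val_eqE rmorph0; apply: (iffP andP).
  case=> a0 aV; exists (ValRingElt aV); apply: val_inj.
  by rewrite [LHS]/= mulfV.
case=> b ab; have ab1 : val a * val b = 1 := congr1 val ab.
have a0 : val a != 0
  by apply/eqP => a0; move/eqP: ab1; rewrite a0 mul0r eq_sym oner_eq0.
split=> //; suff -> : (val a)^-1 = val b by exact: valP.
by apply: (mulfI a0); rewrite ab1 mulfV.
Qed.

Lemma maxidealM (a b : valring_type) : b \in maxideal -> a * b \in maxideal.
Proof.
apply: contraLR => /maxidealPn[c abc1]; apply/maxidealPn; exists (a * c).
by rewrite mulrCA mulrA.
Qed.

Lemma valring_dvd (a b : valring_type) :
  (exists c, a = c * b) \/ (exists c, b = c * a).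
Proof.
have [->|b0] := eqVneq b 0; first by right; exists 0; rewrite mul0r.
have [->|a0] := eqVneq a 0; first by left; exists 0; rewrite mul0r.
rewrite -!val_eqE !rmorph0 in a0 b0.
have /orP[cV|cV] := valring_total V (val a / val b); [left|right];
  exists (ValRingElt cV); apply: val_inj; rewrite rmorphM /= ?divfK //.
by rewrite invf_div divfK.
Qed.

Lemma maxideal_closed : idealr_closed maxideal.
Proof.
have mD a b : a \in maxideal -> b \in maxideal -> a + b \in maxideal.
  have [[c ->]|[c ->]] := valring_dvd a b => ma mb.
    by rewrite -[X in _ + X]mul1r -mulrDl maxidealM.
  by rewrite -[X in X + _]mul1r -mulrDl maxidealM.
split.
- by rewrite unfold_in /maxideal eqxx.
- by apply/maxidealPn; exists 1; rewrite mulr1.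
- by move=> a x y mx my; rewrite mD ?maxidealM.
Qed.

HB.instance Definition _ := isIdealr.Build valring_type maxideal maxideal_closed.

Definition residue_field := {ideal_quot [the idealr valring_type of maxideal]}.

HB.instance Definition _ := GRing.ComNzRing.on residue_field.

Definition residue : valring_type -> residue_field := \pi_residue_field.

HB.instance Definition _ := GRing.RMorphism.copy residue \pi_residue_field.

Lemma residueP (a b : valring_type) :
  reflect (residue a = residue b) (a - b \in maxideal).
Proof. by rewrite Quotient.idealrBE; exact: eqP. Qed.

Lemma residueK (z : residue_field) : residue (repr z) = z.
Proof. exact: reprK. Qed.

Definition residue_inv (z : residue_field) : residue_field :=
  if insub ((val (repr z))^-1) is Some b then residue b else 0.

Lemma residue_eq0 (a : valring_type) : (residue a == 0) = (a \in maxideal).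
Proof.
by rewrite -[X in _ == X](rmorph0 residue) (sameP eqP (residueP a 0)) subr0.
Qed.

Lemma residue_mulVf (z : residue_field) : z != 0 -> residue_inv z * z = 1.
Proof.
rewrite -{1 3}[z]residueK residue_eq0 /residue_inv; set a := repr z => ma.
move: (ma); rewrite unfold_in /maxideal negb_or negbK -val_eqE rmorph0.
case/andP=> a0 aV; rewrite (insubT (mem V) aV) -rmorphM -[RHS](rmorph1 residue).
by congr residue; apply: val_inj; rewrite rmorphM rmorph1 /= mulVf.
Qed.

Lemma residue_inv0 : residue_inv 0 = 0.
Proof.
rewrite /residue_inv; set a := repr _.
have : a \in maxideal by rewrite -residue_eq0 residueK.
rewrite unfold_in /maxideal; case: insubP => [b -> bE /orP[/eqP a0|]|//] //.
suff -> : b = 0 by rewrite rmorph0.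
by apply: val_inj; rewrite bE a0 rmorph0 invr0.
Qed.

HB.instance Definition _ :=
  GRing.ComNzRing_isField.Build residue_field residue_mulVf residue_inv0.

End ResidueField.

(* The value group K^* / V^* of V is isomorphic, as an ordered group, to int:
   v is a surjective group morphism K^* -> int and x V^* >= 0 iff x \in V.
   The value of v at 0 is irrelevant. *)
Definition is_dvr (K : fieldType) (V : valring K) : Prop :=
  exists v : K -> int,
    [/\ forall x y, x != 0 -> y != 0 -> v (x * y) = v x + v y,
        forall n, exists2 x, x != 0 & v x = n
      & forall x, x != 0 -> (x \in V) = (0 <= v x)].

(* The sets c V with c != 0 in V are the basic neighbourhoods of 0 in the
   valuation topology; when V is a DVR they are the powers of its maximal
   ideal. *)
Definition valring_cauchy (K : fieldType) (V : valring K) (u : nat -> K) :=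
  forall c, c \in V -> c != 0 ->
    exists N, forall i j, (N <= i)%N -> (N <= j)%N -> (u i - u j) / c \in V.

Definition valring_cvg (K : fieldType) (V : valring K) (u : nat -> K) (l : K) :=
  forall c, c \in V -> c != 0 ->
    exists N, forall i, (N <= i)%N -> (u i - l) / c \in V.

Definition is_complete (K : fieldType) (V : valring K) : Prop :=
  forall u : nat -> K, (forall i, u i \in V) -> valring_cauchy V u ->
    exists2 l, l \in V & valring_cvg V u l.

(* Every monic polynomial of positive degree has a root. *)
Definition algebraically_closed (k : fieldType) : Prop :=
  GRing.closed_field_axiom k.

(* k carries an ordering making it a real closed field; the ordering is not
   part of the data of k, hence the existential. *)
Definition real_closed (k : fieldType) : Prop :=
  exists (R : rcfType) (f : {rmorphism k -> R}), bijective f.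

Section Extension.
Variables (K L : fieldType) (iota : {rmorphism K -> L}).
Variables (V : valring K) (W : valring L).

(* W :&: K = V, with K identified with its image under iota. *)
Definition extends : Prop := forall a, (iota a \in W) = (a \in V).

Hypothesis VW : extends.

Lemma extends_subproof (a : valring_type V) : iota (val a) \in W.
Proof. by rewrite VW; exact: valP. Qed.

Definition valring_map (a : valring_type V) : valring_type W :=
  ValRingElt (extends_subproof a).

Definition residue_map (z : residue_field V) : residue_field W :=
  residue (valring_map (repr z)).

Lemma valring_mapB (a b : valring_type V) :
  valring_map (a - b) = valring_map a - valring_map b.
Proof. by apply: val_inj; rewrite [LHS]rmorphB. Qed.

Lemma valring_mapM (a b : valring_type V) :
  valring_map (a * b) = valring_map a * valring_map b.
Proof. by apply: val_inj; rewrite [LHS]rmorphM. Qed.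

Lemma valring_map1 : valring_map 1 = 1.
Proof. by apply: val_inj; rewrite [LHS]rmorph1. Qed.

Lemma maxideal_map (a : valring_type V) :
  (valring_map a \in @maxideal _ W) = (a \in @maxideal _ V).
Proof.
congr (_ || ~~ _); last by rewrite -VW fmorphV.
by rewrite -!val_eqE; exact: (fmorph_eq0 iota).
Qed.

Lemma residue_mapE (a : valring_type V) :
  residue_map (residue a) = residue (valring_map a).
Proof.
apply/residueP; rewrite -valring_mapB maxideal_map.
by apply/residueP; rewrite residueK.
Qed.

Lemma residue_map_is_zmod_morphism : zmod_morphism residue_map.
Proof.
move=> x y; rewrite -[x]residueK -[y]residueK -rmorphB !residue_mapE -rmorphB.
by rewrite valring_mapB.
Qed.

Lemma residue_map_is_monoid_morphism : monoid_morphism residue_map.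
Proof.
split=> [|x y].
  rewrite -(rmorph1 (@residue _ V)) residue_mapE valring_map1.
  exact: (rmorph1 (@residue _ W)).
rewrite -[x]residueK -[y]residueK -rmorphM !residue_mapE -rmorphM.
by rewrite valring_mapM.
Qed.

HB.instance Definition _ := GRing.isZmodMorphism.Build
  (residue_field V) (residue_field W) residue_map residue_map_is_zmod_morphism.
HB.instance Definition _ := GRing.isMonoidMorphism.Build
  (residue_field V) (residue_field W) residue_map residue_map_is_monoid_morphism.

Definition residually_algebraic : Prop :=
  forall z : residue_field W, algebraicOver residue_map z.

End Extension.

Definition ratfun (K : fieldType) : fieldType := {fraction {poly K}}.

Definition ratfunC (K : fieldType) : {rmorphism K -> ratfun K} :=
  [the {rmorphism K -> ratfun K} of @tofrac {poly K} \o polyC].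

(* Main.v *)
Require Import Defs.
From HB Require Import structures.
From mathcomp Require Import all_boot all_order all_algebra.
From mathcomp Require Import ring zify complex.
From Stdlib Require Import Classical.

Set Implicit Arguments.
Unset Strict Implicit.
Unset Printing Implicit Defensive.

Import Order.TTheory GRing.Theory Num.Theory.
Local Open Scope ring_scope.

(** An extension as in the statement would make [K(X)] finite over [K], whereas
    [X] is transcendental.

    Let [W] be a discrete valuation domain of [K(X)] over [V], residually
    algebraic. The residue field of [V] being algebraically closed or real
    closed, its algebraic extensions have degree at most 2
    ([algebraic_extension_generator]), so the residue degree of [W] over [V] is
    finite. The ramification index is finite as well, since both value groups
    are the integers. Over a complete discrete valuation domain this forces the
    field extension to be finite ([complete_dvr_finite_extension]): with [p] a
    uniformizer of [V] and [t] one of [W], finitely many products of powers of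
    [t] with lifts of residues span [W] over [V] modulo [p], and successive
    approximation ([approximation_to_expansion]) shows that they span [W] over
    [V]. Multiplying by powers of [p], they span [K(X)] over [K], so every
    rational function is algebraic over [K] ([finite_span_algebraic]), which
    contradicts [ratfunX_transcendental]. *)

(** * Discrete valuation domains *)

Lemma dvr_valuation (K : fieldType) (V : valring K) : is_dvr V ->
  exists v : K -> int,
    [/\ forall x y, x != 0 -> y != 0 -> v (x / y) = v x - v y,
        forall x, x != 0 -> v x^-1 = - v x,
        forall x n, x != 0 -> v (x ^+ n) = n%:Z * v x,
        exists2 t, t != 0 & v t = 1
      & forall x, x != 0 -> (x \in V) = (0 <= v x)].
Proof.
case=> v [vM vsurj vV].
have v1 : v 1 = 0.
  by have := vM 1 1 (oner_neq0 _) (oner_neq0 _); rewrite mulr1; lia.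
have vI x : x != 0 -> v x^-1 = - v x.
  move=> x0; have := vM x x^-1 x0.
  by rewrite invr_eq0 mulfV // v1 => /(_ x0); lia.
exists v; split=> // [x y x0 y0|x n x0].
- by rewrite vM ?invr_eq0 // vI.
- elim: n => [|n IHn]; first by rewrite expr0 v1 mul0r.
  by rewrite exprS vM ?expf_neq0 // IHn intS mulrDl mul1r.
Qed.

(** What the expansions below need from a uniformizer, without reference to the
    valuation: it generates the maximal ideal, and its powers are cofinal among
    the nonzero elements for divisibility. *)
Lemma dvr_uniformizer (K : fieldType) (V : valring K) : is_dvr V ->
  exists t, [/\ t \in V, t^-1 \notin V,
    forall x, x \in V -> x^-1 \notin V -> x / t \in V
    & forall c, c \in V -> c != 0 -> exists n, t ^+ n / c \in V].
Proof.
case/dvr_valuation=> v [vD vI vX [t t0 vt] vV].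
exists t; split.
- by rewrite vV // vt.
- by rewrite vV ?invr_eq0 // vI // vt.
- move=> x; have [->|x0] := eqVneq x 0; first by rewrite mul0r.
  by rewrite !vV ?mulf_neq0 ?invr_eq0 // vD // vI // vt; lia.
- move=> c cV c0; exists `|v c|%N.
  rewrite vV ?mulf_neq0 ?invr_eq0 ?expf_neq0 // vD ?expf_neq0 // vX // vt.
  by rewrite mulr1; lia.
Qed.

(** The value of a nonzero such [x] would exceed every multiple of the positive
    value of [d], which is impossible as the value group is archimedean. *)
Lemma dvr_separated (K : fieldType) (V : valring K) (d x : K) : is_dvr V ->
  d^-1 \notin V -> (forall n, x / d ^+ n \in V) -> x = 0.
Proof.
case/dvr_valuation=> v [vD vI vX _ vV] dV xV.
apply/eqP; apply: contraT => x0.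
have d0 : d != 0 by apply: contraNneq dV => ->; rewrite invr0 rpred0.
have vd : 1 <= v d by move: dV; rewrite vV ?invr_eq0 // vI //; lia.
have := xV (`|v x|.+1)%N.
by rewrite vV ?mulf_neq0 ?invr_eq0 ?expf_neq0 // vD ?expf_neq0 // vX //; nia.
Qed.

(** * Finiteness of the extension *)

(** Successive approximation. If the elements of [W] are [V]-combinations of
    the [b j] modulo [p], iterating on the remainders gives combinations modulo
    every power of [p]; their coefficients are Cauchy in [V], and their limits
    express the given element exactly because [W] is separated. *)
Lemma approximation_to_expansion (K L : fieldType) (iota : {rmorphism K -> L})
    (V : valring K) (W : valring L) (I : finType) (b : I -> L) (p : K) :
  extends iota V W -> is_complete V -> is_dvr W ->
  p \in V -> p^-1 \notin V ->
  (forall c, c \in V -> c != 0 -> exists n, p ^+ n / c \in V) ->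
  (forall j, b j \in W) ->
  (forall x, x \in W -> exists a : {ffun I -> K},
     (forall j, a j \in V)
     /\ (x - \sum_j iota (a j) * b j) / iota p \in W) ->
  forall x, x \in W -> exists a : I -> K, x = \sum_j iota (a j) * b j.
Proof.
move=> VW Vc Wdvr pV pNV pP bW approx x0 x0W.
have p0 : p != 0 by apply: contraNneq pNV => ->; rewrite invr0 rpred0.
have ip0 : iota p != 0 by rewrite fmorph_eq0.
pose good (x : valring_type W) (a : {ffun I -> K}) :=
  [forall j, a j \in V] && ((val x - \sum_j iota (a j) * b j) / iota p \in W).
have exgood x : exists a, good x a.
  have [a [aV aW]] := approx _ (valP x).
  by exists a; rewrite /good aW andbT; apply/forallP.
pose digit x := xchoose (exgood x).
have digitV x j : digit x j \in V.
  by have /andP[/forallP] := xchooseP (exgood x).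
have nextW x : (val x - \sum_j iota (digit x j) * b j) / iota p \in W.
  by have /andP[_] := xchooseP (exgood x).
pose next x : valring_type W := ValRingElt (nextW x).
have nextE x : val x = \sum_j iota (digit x j) * b j + iota p * val (next x).
  by rewrite /= mulrC divfK // addrC subrK.
(* r n is the nth remainder, and A j n the nth approximation of coefficient j *)
pose r n := iter n next (ValRingElt x0W).
pose A j n := \sum_(k < n) p ^+ k * digit (r k) j.
have AV j n : A j n \in V.
  by apply: rpred_sum => k _; rewrite rpredM ?rpredX.
have AS j n : A j n.+1 = A j n + p ^+ n * digit (r n) j.
  by rewrite /A big_ord_recr.
have x0E n : x0 = \sum_j iota (A j n) * b j + iota p ^+ n * val (r n).
  elim: n => [|n IHn].
    rewrite big1 ?add0r ?expr0 ?mul1r // => j _.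
    by rewrite /A big_ord0 rmorph0 mul0r.
  rewrite {1}IHn [val (r n)]nextE; under [in RHS]eq_bigr do
    rewrite AS rmorphD mulrDl rmorphM rmorphXn -mulrA.
  by rewrite big_split -mulr_sumr /= exprS; ring.
have AB j n i : (n <= i)%N -> (A j i - A j n) / p ^+ n \in V.
  move=> /subnK <-; elim: (i - n)%N => [|k IHk].
    by rewrite add0n subrr mul0r rpred0.
  rewrite addSn AS addrAC mulrDl rpredD // exprD mulrAC mulfK ?expf_neq0 //.
  by rewrite rpredM ?rpredX.
have Acauchy j : valring_cauchy V (A j).
  move=> c cV c0; have [n nP] := pP c cV c0; exists n => i k ni nk.
  suff -> : (A j i - A j k) / c =
    ((A j i - A j n) / p ^+ n - (A j k - A j n) / p ^+ n) * (p ^+ n / c).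
    by rewrite rpredM // rpredB ?AB.
  rewrite -mulrBl mulrA divfK ?expf_neq0 //; congr (_ / c); ring.
have limP j : exists l, valring_cvg V (A j) l.
  by have [l _ ?] := Vc _ (AV j) (Acauchy j); exists l.
have [l lP] := fin_all_exists limP.
exists l; apply/eqP; rewrite -subr_eq0; apply/eqP.
apply: (dvr_separated Wdvr (d := iota p)); first by rewrite -fmorphV VW.
move=> n.
have [N NP] : exists N, forall j i, (N <= i)%N -> (A j i - l j) / p ^+ n \in V.
  have /fin_all_exists[N NP] j :
      exists N, forall i, (N <= i)%N -> (A j i - l j) / p ^+ n \in V.
    by apply: lP; rewrite ?rpredX ?expf_neq0.
  exists (\max_j N j)%N => j i ij; apply: NP; apply: leq_trans ij.
  exact: leq_bigmax.
rewrite {1}(x0E (N + n)%N) addrAC -sumrB mulrDl rpredD //.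
  rewrite mulr_suml rpred_sum // => j _.
  rewrite -mulrBl mulrAC rpredM // -rmorphB -rmorphXn -fmorph_div VW.
  by rewrite NP ?leq_addr.
rewrite exprD mulrAC mulfK ?expf_neq0 //.
by rewrite rpredM //; [rewrite rpredX ?VW | exact: valP].
Qed.

(** The leading digit of [x]: lifting to [V] the coordinates of its residue
    leaves a remainder in the maximal ideal of [W], which [t] divides. The
    residues [s j] are lifted to [W] by their chosen representatives. *)
Lemma residue_digit (K L : fieldType) (iota : {rmorphism K -> L})
    (V : valring K) (W : valring L) (VW : extends iota V W) (n : nat)
    (s : 'I_n -> residue_field W) (t x : L) :
  (forall z, exists c, z = \sum_j residue_map VW (c j) * s j) ->
  (forall y, y \in W -> y^-1 \notin W -> y / t \in W) ->
  x \in W -> exists c : 'I_n -> K,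
    (forall j, c j \in V) /\ (x - \sum_j iota (c j) * val (repr (s j))) / t \in W.
Proof.
move=> sP tP xW; have [c cE] := sP (residue (ValRingElt xW)).
exists (fun j => val (repr (c j))); split=> [j|]; first exact: valP.
set y := \sum_j valring_map VW (repr (c j)) * repr (s j).
have yE : \sum_j iota (val (repr (c j))) * val (repr (s j)) = val y.
  by rewrite /y rmorph_sum; apply: eq_bigr => j _; rewrite rmorphM.
have : ValRingElt xW - y \in @maxideal _ W.
  apply/residueP; rewrite cE [RHS](rmorph_sum (@residue _ W)).
  by apply: eq_bigr => j _; rewrite [RHS]rmorphM -[s j in LHS]residueK.
rewrite unfold_in /maxideal yE => /orP[/eqP/(congr1 val)|].
  by rewrite rmorphB rmorph0 /= => ->; rewrite mul0r rpred0.
by rewrite rmorphB; apply: tP; rewrite rpredB //; exact: (valP y).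
Qed.

Lemma digits_expansion (K L : fieldType) (iota : {rmorphism K -> L})
    (V : valring K) (W : valring L) (n : nat) (S : 'I_n -> L) (t : L) :
  t != 0 ->
  (forall x, x \in W -> exists c : 'I_n -> K,
    (forall j, c j \in V) /\ (x - \sum_j iota (c j) * S j) / t \in W) ->
  forall m x, x \in W -> exists c : nat -> 'I_n -> K,
    (forall i j, c i j \in V)
    /\ (x - \sum_(i < m) \sum_j iota (c i j) * (t ^+ i * S j)) / t ^+ m \in W.
Proof.
move=> t0 step; elim=> [|m IHm] x xW.
  exists (fun _ _ => 0); split=> [i j|]; first exact: rpred0.
  by rewrite big_ord0 subr0 expr0 divr1.
have [c [cV cW]] := step x xW; have [d [dV dW]] := IHm _ cW.
exists (fun i => if i is k.+1 then d k else c); split=> [[|i] j|] //.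
rewrite big_ord_recl /=; move: dW; congr (_ \in W).
rewrite exprS invfM mulrA; congr (_ / _).
apply: (mulIf t0); rewrite mulrBl !divfK // opprD addrA; congr (_ - _ - _).
  by apply: eq_bigr => j _; rewrite expr0 mul1r.
rewrite mulr_suml; apply: eq_bigr => i _; rewrite mulr_suml.
by apply: eq_bigr => j _; rewrite /bump /= add1n exprS; ring.
Qed.

(** Let [t ^+ e] be a power of the uniformizer of [W] that is a multiple of the
    uniformizer [p] of [V]. The spanning family consists of the lifts of the
    [s j] times [t ^+ i] with [i < e]: expanding [e] digits in base [t] gives
    every element of [W] modulo [t ^+ e], hence modulo [p]. *)
Lemma complete_dvr_finite_extension (K L : fieldType)
    (iota : {rmorphism K -> L}) (V : valring K) (W : valring L)
    (VW : extends iota V W) (n : nat) (s : 'I_n -> residue_field W) :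
  is_dvr V -> is_complete V -> is_dvr W ->
  (forall z, exists c, z = \sum_j residue_map VW (c j) * s j) ->
  exists (I : finType) (b : I -> L),
    forall x, exists a : I -> K, x = \sum_j iota (a j) * b j.
Proof.
move=> Vdvr Vc Wdvr sP.
have [p [pV pNV _ pP]] := dvr_uniformizer Vdvr.
have [t [tW tNW tP teP]] := dvr_uniformizer Wdvr.
have p0 : p != 0 by apply: contraNneq pNV => ->; rewrite invr0 rpred0.
have ip0 : iota p != 0 by rewrite fmorph_eq0.
have t0 : t != 0 by apply: contraNneq tNW => ->; rewrite invr0 rpred0.
have [e eP] : exists e, t ^+ e / iota p \in W by apply: teP; rewrite ?VW.
pose b (k : 'I_e * 'I_n) := t ^+ k.1 * val (repr (s k.2)).
have bW k : b k \in W by rewrite rpredM ?rpredX //; exact: valP.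
have spanW : forall x, x \in W -> exists a, x = \sum_k iota (a k) * b k.
  apply: (approximation_to_expansion VW Vc Wdvr pV pNV pP bW) => x xW.
  have [c [cV cW]] :=
    digits_expansion t0 (fun x => residue_digit sP tP (x := x)) e xW.
  exists [ffun k : 'I_e * 'I_n => c k.1 k.2]; split=> [k|]; first by rewrite ffunE.
  move: (rpredM cW eP); congr (_ \in W).
  rewrite mulrA divfK ?expf_neq0 // pair_bigA; congr ((_ - _) / _).
  by apply: eq_bigr => k _; rewrite ffunE.
exists [the finType of ('I_e * 'I_n)%type], b => x.
have [xW|xNW] := boolP (x \in W).
  by have [a xE] := spanW x xW; exists a.
have x0 : x != 0 by apply: contraNneq xNW => ->; rewrite rpred0.
(* If no multiple x p^m were in W, all 1 / (x p^m) would be, so that 1 / x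
   would be divisible by every power of p. *)
have [m mP] : exists m, x * iota p ^+ m \in W.
  apply: NNPP => H; move/eqP: x0; apply; apply: invr_inj; rewrite invr0.
  apply: (dvr_separated Wdvr (d := iota p)); first by rewrite -fmorphV VW.
  move=> m; have /orP[xpW|] := valring_total W (x * iota p ^+ m).
    by case: H; exists m.
  by rewrite invfM.
have [a xE] := spanW _ mP; exists (fun k => a k / p ^+ m).
apply: (mulIf (expf_neq0 m ip0)); rewrite xE mulr_suml; apply: eq_bigr => k _.
by rewrite fmorph_div rmorphXn mulrAC divfK ?expf_neq0.
Qed.

(** The coordinates of the first [#|I|.+1] powers of [x] form a matrix with
    more rows than columns, so these powers are linearly dependent. *)
Lemma finite_span_algebraic (K L : fieldType) (iota : {rmorphism K -> L})
    (I : finType) (b : I -> L) :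
  (forall x, exists a : I -> K, x = \sum_j iota (a j) * b j) ->
  forall x, algebraicOver iota x.
Proof.
move=> bP x.
have /fin_all_exists[a aE] (i : 'I_(#|I|.+1)) := bP (x ^+ i).
pose M := \matrix_(i < #|I|.+1, j < #|I|) a i (enum_val j).
have [u u0 uM] : exists2 u : 'rV_(#|I|.+1), u != 0 & u *m M = 0.
  have : kermx M != 0.
    rewrite -mxrank_eq0 mxrank_ker subn_eq0 -ltnNge ltnS.
    exact: rank_leq_col.
  by move/rowV0Pn => [u /sub_kermxP uM u0]; exists u.
exists (\poly_(i < #|I|.+1) u 0 (inord i)).
  apply: contraNneq u0 => p0; apply/eqP/rowP => i.
  by rewrite mxE -(coef0 K i) -p0 coef_poly ltn_ord inord_val.
rewrite rootE poly_def rmorph_sum horner_sum.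
under eq_bigr => i _ do
  rewrite /= map_polyZ map_polyXn hornerZ hornerXn inord_val aE mulr_sumr.
rewrite exchange_big big1 //= => j _.
under eq_bigr do rewrite mulrA -rmorphM; rewrite -mulr_suml -rmorph_sum.
have /rowP/(_ (enum_rank j)) := uM; rewrite !mxE.
under eq_bigr do rewrite mxE enum_rankK.
by move=> ->; rewrite rmorph0 mul0r.
Qed.

(** * Algebraic extensions of algebraically closed and real closed fields *)

(** Dividing out nonconstant factors one at a time, a root of [p] is caught by
    one of them. *)
Lemma root_of_factor (F E : fieldType) (h : {rmorphism F -> E})
    (P : {poly F} -> Prop) :
  (forall p : {poly F}, (1 < size p)%N ->
     exists q, [/\ P q, (1 < size q)%N & q %| p]) ->
  forall z, algebraicOver h z -> exists2 q, P q & root (map_poly h q) z.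
Proof.
move=> factor z [p p0 pz].
have [n] := ubnP (size p); elim: n p p0 pz => // n IHn p p0 pz.
rewrite ltnS => pn.
have p1 : (1 < size p)%N.
  by rewrite -(size_map_poly h) (root_size_gt1 _ pz) // map_poly_eq0.
have [q [Pq q1 qp]] := factor p p1.
have q0 : q != 0 by rewrite -size_poly_gt0 ltnW.
move: pz; rewrite -{1}(divpK qp) rmorphM rootM => /orP[] rz; last by exists q.
apply: IHn rz _.
  by apply: contraNneq p0 => pq0; rewrite -(divpK qp) pq0 mul0r.
apply: leq_trans pn; rewrite size_divp //.
move: (size p) (size q) p1 q1 => m k; lia.
Qed.

Lemma algebraically_closed_root (F : fieldType) (p : {poly F}) :
  algebraically_closed F -> (1 < size p)%N -> exists x, root p x.
Proof.
move=> Fc p1; have [|x xE] := Fc (size p).-1 (fun i => - p`_i / lead_coef p).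
  by rewrite -ltnS prednK // ltnW.
have l0 : lead_coef p != 0 by rewrite lead_coef_eq0 -size_poly_gt0 ltnW.
exists x; rewrite rootE horner_coef -[size p]prednK ?(ltnW p1) // big_ord_recr /=.
rewrite -/(lead_coef p) xE mulr_sumr -big_split big1 //= => i _.
by rewrite mulrA mulrCA mulfV // mulr1; ring.
Qed.

(** A complex root [a + b i] of [p] is also a root of the real polynomial
    [('X - a)^2 + b^2]; hence the gcd of the two is not constant. *)
Lemma rcf_quadratic_factor (R : rcfType) (p : {poly R}) : (1 < size p)%N ->
  exists q, [/\ exists a b, q %| ('X - a%:P) ^+ 2 + (b ^+ 2)%:P,
    (1 < size q)%N & q %| p].
Proof.
move=> p1; pose c := real_complex R.
have [x xp] : exists x, root (map_poly c p) x.
  by apply/closed_rootP; rewrite size_map_poly; case: size p1 => [|[]].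
case: x xp => a b xp; pose Q := ('X - a%:P) ^+ 2 + (b ^+ 2)%:P.
have xQ : root (map_poly c Q) (a +i* b)%C.
  rewrite rootE /Q rmorphD rmorphXn rmorphB /= map_polyX !map_polyC /=.
  rewrite !hornerE; apply/eqP; simpc; congr (_ +i* _)%C; ring.
have p0 : p != 0 by rewrite -size_poly_gt0 ltnW.
exists (gcdp p Q); split; [by exists a, b; exact: dvdp_gcdr | | exact: dvdp_gcdl].
rewrite -(size_map_poly c) (root_size_gt1 (a := (a +i* b)%C)) //.
  by rewrite map_poly_eq0 gcdp_eq0 (negPf p0).
by rewrite gcdp_map root_gcd xp.
Qed.

(** By the quadratic factors, every [z] satisfies [(z - a)^2 = - b^2] with [a]
    and [b] in [R]. If [E] contains a square root [i] of [-1], this gives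
    [z = a + b i] or [z = a - b i]; otherwise [b] has to vanish. *)
Lemma algebraic_over_rcf (R : rcfType) (E : fieldType) (h : {rmorphism R -> E}) :
  (forall z, algebraicOver h z) ->
  exists s, forall z, exists a b, z = h a + h b * s.
Proof.
move=> alg.
have quad z : exists a b, (z - h a) ^+ 2 + h b ^+ 2 = 0.
  have [q [a [b /dvdpP[r qr]]] qz] :=
    root_of_factor (@rcf_quadratic_factor R) (alg z).
  exists a, b; have : root (map_poly h (('X - a%:P) ^+ 2 + (b ^+ 2)%:P)) z.
    by rewrite qr rmorphM rootM qz orbT.
  rewrite rootE rmorphD rmorphXn rmorphB /= map_polyX !map_polyC /= !hornerE.
  by rewrite rmorphXn => /eqP.
have [[i i2]|noi] := classic (exists i : E, i ^+ 2 = -1).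
  exists i => z; have [a [b ab]] := quad z.
  have : (z - h a - h b * i) * (z - h a + h b * i) = 0.
    by rewrite -subr_sqr exprMn i2 mulrN1 opprK.
  move/eqP; rewrite mulf_eq0 => /orP[]/eqP zE.
    by exists a, b; rewrite -[LHS]subr0 -zE; ring.
  by exists a, (- b); rewrite -[LHS]subr0 -zE rmorphN; ring.
exists 0 => z; have [a [b ab]] := quad z; exists a, 0.
have [b0|b0] := eqVneq b 0.
  move/eqP: ab; rewrite b0 rmorph0 expr0n addr0 expf_eq0 subr_eq0 => /eqP->.
  by rewrite mulr0 addr0.
case: noi; exists ((z - h a) / h b).
have hb : h b ^+ 2 != 0 by rewrite expf_neq0 ?fmorph_eq0.
apply: (mulIf hb); rewrite expr_div_n divfK // mulN1r.
by apply/eqP; rewrite -addr_eq0 ab.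
Qed.

(** The extension has degree at most 2, whence the uniform shape of its elements:
    over an algebraically closed field it is trivial, by linear factors, and
    [s] can be 0. The real closed case is transported along the isomorphism. *)
Lemma algebraic_extension_generator (k E : fieldType) (h : {rmorphism k -> E}) :
  algebraically_closed k \/ real_closed k -> (forall z, algebraicOver h z) ->
  exists s, forall z, exists a b, z = h a + h b * s.
Proof.
case=> [kc alg|[R [f [g fK gK]]] alg].
  exists 0 => z.
  pose P (q : {poly k}) := exists a : k, q = 'X - a%:P.
  have factor (p : {poly k}) :
      (1 < size p)%N -> exists q, [/\ P q, (1 < size q)%N & q %| p].
    move=> p1; have [a pa] := algebraically_closed_root kc p1.
    by exists ('X - a%:P); rewrite dvdp_XsubCl size_XsubC; split=> //; exists a.
  have [_ [a ->]] := root_of_factor factor (alg z).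
  rewrite /= map_polyXsubC root_XsubC => /eqP->.
  by exists a, 0; rewrite mulr0 addr0.
pose gM := GRing.isZmodMorphism.Build R k g (can2_zmod_morphism fK gK).
pose gMM := GRing.isMonoidMorphism.Build R k g (can2_monoid_morphism fK gK).
pose G : {rmorphism R -> k} := HB.pack g gM gMM.
have [|s sP] := @algebraic_over_rcf R E (h \o G).
  move=> z; have [p p0 pz] := alg z; exists (map_poly f p).
    by rewrite map_poly_eq0.
  rewrite map_poly_comp -[map_poly G _]map_poly_comp.
  rewrite [X in map_poly h X](_ : _ = p) //.
  by rewrite map_poly_id // => x _; exact: fK.
by exists s => z; have [a [b ->]] := sP z; exists (G a), (G b).
Qed.

(** * Rational functions *)

Lemma ratfunX_transcendental (K : fieldType) :
  ~ algebraicOver (ratfunC K) (tofrac ('X : {poly K})).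
Proof.
case=> p p0; rewrite rootE.
have -> : (map_poly (ratfunC K) p).[tofrac 'X] = tofrac p.
  rewrite map_poly_comp horner_map -[p in RHS]comp_polyXr.
  by rewrite /comp_poly.
by rewrite tofrac_eq0 (negPf p0).
Qed.

Theorem corollary4p9 (K : fieldType) (V : valring K)
    (V_dvr : is_dvr V) (V_complete : is_complete V)
    (res_closed : algebraically_closed (residue_field V)
                  \/ real_closed (residue_field V)) :
  ~ exists (W : valring (ratfun K)) (VW : extends (ratfunC K) V W),
      is_dvr W /\ residually_algebraic VW.
Proof.
case=> W [VW [W_dvr alg]].
have [s sP] := algebraic_extension_generator res_closed alg.
have [|I [b bP]] := @complete_dvr_finite_extension _ _ _ _ _ VW 2
  (fun j => if j == 0 then 1 else s) V_dvr V_complete W_dvr.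
  move=> z; have [c [d ->]] := sP z; exists (fun j => if j == 0 then c else d).
  by rewrite !big_ord_recl big_ord0 /= mulr1 addr0.
exact: (ratfunX_transcendental (finite_span_algebraic bP _)).
Qed.
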